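(* Let $G/H$ be a quasi-affine spherical homogeneous space with spherical functions $\phi_\lambda$, $\lambda\in\Lambda^+_{G/H}$. Suppose $V_\lambda$ and $V_\mu$ appear in $\mathbb{C}[G/H]$ and suppose $V_\gamma$ appears in $\langle V_\lambda\cdot V_\mu\rangle\subseteq\mathbb{C}[G/H]$. Then there exists a constant $c>0$ such that for all $x\in G/H$ $$\phi_\lambda(x)\,\phi_\mu(x)\ \geq\ c\,\phi_\gamma(x).$$ In particular, since $V_{\lambda+\mu}$ always appears in $\langle V_\lambda\cdot V_\mu\rangle$, there is a constant $c>0$ such that $\phi_\lambda(x)\phi_\mu(x)\geq c\,\phi_{\lambda+\mu}(x)$ for all $x\in G/H$.
   Context: $G$ is a connected reductive algebraic group over $\mathbb{C}$, $B\subset G$ a Borel subgroup, $K$ a maximal compact subgroup of $G$. A homogeneous space $G/H$ ($H$ a closed algebraic subgroup) is spherical if $B$ has a dense orbit in it; $G/H$ is assumed to be a quasi-affine variety. $G$ acts on the ring of regular functions $\mathbb{C}[G/H]$ by $(g\cdot f)(x)=f(g^{-1}x)$, and $\mathbb{C}[G/H]=\bigoplus_{\lambda\in\Lambda^+_{G/H}}V_\lambda$ is multiplicity-free, where $V_\lambda$ is the irreducible $G$-module of highest weight $\lambda$ (with respect to $B$) and $\Lambda^+_{G/H}$ is the semigroup of highest weights that occur. For a $G$-module $W$, ''$V_\gamma$ appears in $W$'' means that the decomposition of $W$ into irreducibles contains a copy of $V_\gamma$. $\langle V_\lambda\cdot V_\mu\rangle$ is the $\mathbb{C}$-span of the products $f\cdot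 g\in\mathbb{C}[G/H]$ with $f\in V_\lambda$, $g\in V_\mu$. Spherical functions: for $\lambda\in\Lambda^+_{G/H}$ choose a $K$-invariant Hermitian product on $V_\lambda\subset\mathbb{C}[G/H]$ and an orthonormal basis $\{f_{\lambda,i}\}_i$ of $V_\lambda$; $\phi_\lambda:G/H\to\mathbb{R}_{>0}$ is the function $x\mapsto\sum_i|f_{\lambda,i}(x)|^2$ rescaled by a positive constant so that $\phi_\lambda(eH)=1$. *)

(* Defs.v *)
From HB Require Import structures.
From mathcomp Require Import all_boot all_order all_algebra.
From mathcomp Require Import all_classical all_reals all_analysis.
From mathcomp Require Import complex.
From mathcomp Require mpoly.

Set Implicit Arguments.
Unset Strict Implicit.
Unset Printing Implicit Defensive.

Import Order.TTheory GRing.Theory Num.Theory numFieldNormedType.Exports.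

Local Open Scope classical_set_scope.
Local Open Scope ring_scope.

Section Zariski.
Context {R : realType} {N : nat} {T : Type}.
Local Notation C := R[i].

(* In this section a map e : T -> C^N plays the role of a system of
   coordinates: T carries the Zariski topology and the sheaf of regular
   functions induced from the affine space C^N along e. *)
Implicit Types (e : T -> 'rV[C]_N) (U Z : set T) (f : T -> C).

Definition peval (x : 'rV[C]_N) (p : mpoly.mpoly N C) : C :=
  mpoly.meval (fun i => x 0 i) p.

Definition zclosed e Z :=
  exists S : set (mpoly.mpoly N C),
    forall t, Z t <-> forall p, S p -> peval (e t) p = 0.

Definition zopen e U := zclosed e (~` U).

Definition regular_on e U f :=
  forall t, U t -> exists W : set T,
    [/\ zopen e W, W t, W `<=` U &
      exists p q : mpoly.mpoly N C, forall s, W s ->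
        peval (e s) q != 0 /\ f s = peval (e s) p / peval (e s) q].

Definition zconnected e U :=
  forall Z1 Z2 : set T, zclosed e Z1 -> zclosed e Z2 ->
    U `<=` Z1 `|` Z2 -> U `&` Z1 `&` Z2 = set0 ->
    U `<=` Z1 \/ U `<=` Z2.

End Zariski.

Section AbstractGroups.
Context {G : groupType}.
Implicit Types A S : set G.

Definition subgroup A :=
  [/\ A 1%g, forall x y, A x -> A y -> A (x * y)%g
    & forall x, A x -> A x^-1%g].

Definition normal_subgroup A :=
  subgroup A /\ forall g x, A x -> A (g * x * g^-1)%g.

Definition generated S : set G :=
  [set x | forall A, subgroup A -> S `<=` A -> A x].

Definition derived A : set G :=
  generated [set z | exists x y,
    [/\ A x, A y & z = (x * y * x^-1 * y^-1)%g]].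

Definition solvable_group A := exists k, iter k derived A = [set 1%g].

End AbstractGroups.

Section AlgebraicGroups.
Context {R : realType} {n : nat} {G : groupType}.
Local Notation C := R[i].
Variable rho : G -> 'M[C]_n.

(* rho identifies G with a Zariski closed subgroup of GL_n(C). *)
Definition linear_algebraic_group :=
  [/\ rho 1%g = 1%:M,
      forall x y, rho (x * y)%g = rho x *m rho y,
      injective rho
    & exists S : set (mpoly.mpoly (n * n) C), forall M : 'M[C]_n,
        (exists g, rho g = M) <->
        M \in unitmx /\ forall p, S p -> peval (mxvec M) p = 0].

Definition group_coord (g : G) : 'rV[C]_(n * n) := mxvec (rho g).

Definition closed_subgroup (A : set G) := subgroup A /\ zclosed group_coord A.

Definition unipotent_set (A : set G) :=
  forall u, A u -> exists k, (rho u - 1%:M) ^+ k = 0.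

(* The unipotent radical is the largest closed connected normal unipotent
   subgroup, so it is trivial iff every such subgroup is. *)
Definition reductive :=
  forall U : set G, closed_subgroup U -> normal_subgroup U ->
    zconnected group_coord U -> unipotent_set U -> U = [set 1%g].

Definition connected_solvable (A : set G) :=
  [/\ closed_subgroup A, zconnected group_coord A & solvable_group A].

Definition borel (B : set G) :=
  connected_solvable B /\
  forall B', connected_solvable B' -> B `<=` B' -> B' = B.

(* The ascription gives 'M[C]_n the Euclidean topology. *)
Definition compact_subgroup (K : set G) :=
  subgroup K /\ compact (rho @` K : set 'M[C : numFieldType]_n).

Definition maximal_compact (K : set G) :=
  compact_subgroup K /\
  forall K', compact_subgroup K' -> K `<=` K' -> K' = K.

End AlgebraicGroups.

Section HomogeneousSpace.
Context {G : groupType}.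
Variable H : set G.

Definition left_coset (g : G) : set G := [set (g * h)%g | h in H].

Definition homog := {X : set G | exists g, X = left_coset g}.

Definition proj (g : G) : homog :=
  exist _ (left_coset g) (ex_intro _ g erefl).

Lemma act_subproof (g : G) (x : homog) :
  exists g', [set (g * y)%g | y in sval x] = left_coset g'.
Proof.
case: x => X [a aX] /=; rewrite aX; exists (g * a)%g; rewrite /left_coset.
rewrite eqEsubset; split => z /=.
  by case=> y [h Hh <-] <-; exists h => //; rewrite mulgA.
by case=> h Hh <-; exists (a * h)%g; [exists h | rewrite mulgA].
Qed.

Definition act (g : G) (x : homog) : homog :=
  exist _ [set (g * y)%g | y in sval x] (act_subproof g x).

End HomogeneousSpace.

Section RegularFunctions.
Context {R : realType} {n : nat} {G : groupType}.
Local Notation C := R[i].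
Variables (rho : G -> 'M[C]_n) (H : set G).
Local Notation X := (homog H).

(* G/H has the quotient topology, and its regular functions on an open set U
   are the functions whose pullback to G is regular on the preimage of U. *)
Definition hclosed (Z : set X) := zclosed (group_coord rho) (proj H @^-1` Z).

Definition hopen (U : set X) := hclosed (~` U).

Definition hregular_on (U : set X) (f : X -> C) :=
  regular_on (group_coord rho) (proj H @^-1` U) (f \o proj H).

Definition regfun : set (X -> C) := [set f | hregular_on setT f].

(* G/H is isomorphic, as a variety, to a locally closed subset of C^m. *)
Definition quasi_affine :=
  exists m (j : X -> 'rV[C]_m),
    [/\ injective j,
        exists Z1 Z2 : set 'rV[C]_m,
          [/\ zclosed id Z1, zclosed id Z2 & range j = Z1 `\` Z2],
        forall Z, hclosed Z <-> zclosed j Z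
      & forall U f, hopen U -> (hregular_on U f <-> regular_on j U f)].

Definition spherical (B : set G) :=
  exists x : X, forall Z, hclosed Z -> (forall b, B b -> Z (act b x)) ->
    Z = setT.

Definition translate (g : G) (f : X -> C) : X -> C :=
  fun x => f (act g^-1%g x).

Definition subspace (V : set (X -> C)) :=
  V (fun=> 0) /\
  forall a f g, V f -> V g -> V (fun x => a * f x + g x).

Definition submodule (V : set (X -> C)) :=
  [/\ subspace V, V `<=` regfun & forall g f, V f -> V (translate g f)].

Definition irreducible (V : set (X -> C)) :=
  [/\ submodule V, V <> [set (fun=> 0)]
    & forall W, submodule W -> W `<=` V -> W = [set (fun=> 0)] \/ W = V].

Definition span_set (S : set (X -> C)) : set (X -> C) :=
  [set f | forall V, subspace V -> S `<=` V -> V f].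

Definition product_span (V W : set (X -> C)) : set (X -> C) :=
  span_set [set k | exists f g, [/\ V f, W g & k = (fun x => f x * g x)]].

End RegularFunctions.

Section Weights.
Context {R : realType} {n : nat} {G : groupType}.
Local Notation C := R[i].
Variables (rho : G -> 'M[C]_n) (B : set G).

(* Functions on B itself, so that distinct weights are distinct functions. *)
Definition weight := {b : G | B b} -> C.
Implicit Types lambda mu : weight.

Definition character lambda :=
  [/\ forall b, sval b = 1%g -> lambda b = 1,
      forall a b c, sval c = (sval a * sval b)%g ->
        lambda c = lambda a * lambda b
    & regular_on (fun b : {b : G | B b} => group_coord rho (sval b)) setT lambda].

(* The group law on characters, written additively for weights. *)
Definition weight_add lambda mu : weight := fun b => lambda b * mu b.

Variable H : set G.
Local Notation X := (homog H).
Implicit Types (V W : set (X -> C)) (f : X -> C).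

Definition highest_weight_vector lambda f :=
  f <> (fun=> 0) /\
  forall b : {b : G | B b}, translate (sval b) f = (fun x => lambda b * f x).

Definition irreducible_of_highest_weight lambda V :=
  [/\ irreducible rho V, character lambda
    & exists2 f, V f & highest_weight_vector lambda f].

Definition appears lambda W :=
  exists2 V, irreducible_of_highest_weight lambda V & V `<=` W.

Definition Lambda_plus : set weight :=
  [set lambda | appears lambda (regfun rho (H := H))].

(* C[G/H] is the internal direct sum of the V lambda, lambda in
   Lambda_plus. *)
Definition multiplicity_free_decomposition (V : weight -> set (X -> C)) :=
  [/\ forall lambda, Lambda_plus lambda ->
        irreducible_of_highest_weight lambda (V lambda),
      forall f, regfun rho f -> exists m (l : 'I_m -> weight) F,
        [/\ forall i, Lambda_plus (l i), forall i, V (l i) (F i)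
          & f = (fun x => \sum_(i < m) F i x)]
    & forall m (l : 'I_m -> weight) F, injective l ->
        (forall i, Lambda_plus (l i)) -> (forall i, V (l i) (F i)) ->
        (forall x, \sum_(i < m) F i x = 0) ->
        forall i, F i = (fun=> 0)].

End Weights.

Section SphericalFunctions.
Context {R : realType} {G : groupType}.
Local Notation C := R[i].
Variables (K H : set G).
Local Notation X := (homog H).

(* h is only meaningful on V x V. *)
Definition invariant_hermitian_product (V : set (X -> C))
    (h : (X -> C) -> (X -> C) -> C) :=
  [/\ forall a f1 f2 g, V f1 -> V f2 -> V g ->
        h (fun x => a * f1 x + f2 x) g = a * h f1 g + h f2 g,
      forall f g, V f -> V g -> h g f = (h f g)^*,
      forall f, V f -> f <> (fun=> 0) -> 0 < h f f
    & forall k f g, K k -> V f -> V g ->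
        h (translate k f) (translate k g) = h f g].

Definition orthonormal_basis (V : set (X -> C))
    (h : (X -> C) -> (X -> C) -> C) (d : nat) (f : 'I_d -> X -> C) :=
  [/\ forall i, V (f i),
      forall i j, h (f i) (f j) = (i == j)%:R
    & forall v, V v -> exists a : 'I_d -> C,
        v = (fun x => \sum_(i < d) a i * f i x)].

Definition spherical_function (V : set (X -> C)) (phi : X -> R) :=
  exists h d (f : 'I_d -> X -> C) (c : R),
    [/\ invariant_hermitian_product V h,
        orthonormal_basis V h f,
        0 < c,
        forall x, phi x = c * \sum_(i < d) Normc.normc (f i x) ^+ 2
      & phi (proj H 1%g) = 1].

End SphericalFunctions.

(* Main.v *)
(* A nonzero B-eigenfunction does not vanish at a point x0 of a dense B-orbit,
   so B-eigenfunctions of equal weight are proportional. Hence an irreducible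
   submodule of C[G/H] is determined by any weight of a B-eigenfunction in it:
   the copy of V gamma in the product span is V gamma itself. Writing an
   orthonormal basis of V gamma in terms of products of basis elements of
   V lambda and V mu bounds phi gamma by a multiple of phi lambda * phi mu.
   For gamma = lambda + mu, the product of the two highest weight vectors is
   nonzero at x0, and by directness of the decomposition each of its components
   is again a B-eigenfunction of weight lambda + mu, hence proportional to it;
   so it lies in a single summand. *)

Require Import Defs.
From HB Require Import structures.
From mathcomp Require Import all_boot all_order all_algebra.
From mathcomp Require Import all_classical all_reals all_analysis.
From mathcomp Require Import complex.
From mathcomp Require Import (canonicals) mpoly.
From mathcomp Require Import ring.

Set Implicit Arguments.
Unset Strict Implicit.
Unset Printing Implicit Defensive.

Import Order.TTheory GRing.Theory Num.Theory numFieldNormedType.Exports.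

Local Open Scope classical_set_scope.
Local Open Scope ring_scope.

(** * Zariski open sets and regular functions *)

Section ZariskiRegularity.
Context {R : realType} {N : nat} {T : Type}.
Local Notation C := R[i].
Implicit Types (e : T -> 'rV[C]_N) (U Z : set T) (f g : T -> C).

Lemma pevalD (x : 'rV[C]_N) (p q : mpoly.mpoly N C) :
  peval x (p + q) = peval x p + peval x q.
Proof. exact: mpoly.mevalD. Qed.

Lemma pevalM (x : 'rV[C]_N) (p q : mpoly.mpoly N C) :
  peval x (p * q) = peval x p * peval x q.
Proof. exact: mpoly.mevalM. Qed.

Lemma pevalC (x : 'rV[C]_N) (a : C) : peval x (mpoly.mpolyC N a) = a.
Proof. exact: mpoly.mevalC. Qed.

(** The non-vanishing loci of polynomials form a base of the topology, and a closed set is cut out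
    by all polynomials vanishing on it. Openness becomes a pointwise witness, which can be
    multiplied with others. *)
Lemma zopenP e U :
  zopen e U <-> forall t, U t -> exists p : mpoly.mpoly N C,
    peval (e t) p != 0 /\ forall s, ~ U s -> peval (e s) p = 0.
Proof.
split=> [[S hS] t Ut|hU].
  apply: contrapT => hn.
  have /hS : forall p, S p -> peval (e t) p = 0.
    move=> p Sp; apply/eqP; apply: contrapT => /negP tp; apply: hn.
    by exists p; split=> // s nUs; move/hS: nUs; apply.
  by apply.
exists [set p | forall s, ~ U s -> peval (e s) p = 0] => t; split.
  by move=> nUt p; apply.
move=> h Ut; have [p [tp pU]] := hU t Ut.
by move/negP: tp; apply; rewrite (h p pU).
Qed.

Lemma zopenI e U Z : zopen e U -> zopen e Z -> zopen e (U `&` Z).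
Proof.
move=> /zopenP hU /zopenP hZ; apply/zopenP => t [Ut Zt].
have [p [tp pU]] := hU t Ut; have [q [tq qZ]] := hZ t Zt.
exists (p * q); split=> [|s nUZ]; first by rewrite pevalM mulf_neq0.
rewrite pevalM; case: (EM (U s)) => [Us|/pU ->]; last by rewrite mul0r.
by rewrite (qZ s) ?mulr0 // => Zs; apply: nUZ.
Qed.

Lemma regular_on_lin e U (a : C) f g :
  regular_on e U f -> regular_on e U g ->
  regular_on e U (fun t => a * f t + g t).
Proof.
move=> hf hg t Ut.
have [W1 [oW1 W1t W1U [p1 [q1 h1]]]] := hf t Ut.
have [W2 [oW2 W2t W2U [p2 [q2 h2]]]] := hg t Ut.
exists (W1 `&` W2); split=> //; [exact: zopenI | by move=> s [/W1U] |].
exists (mpoly.mpolyC N a * p1 * q2 + p2 * q1), (q1 * q2) => s [W1s W2s].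
have [q1s ->] := h1 s W1s; have [q2s ->] := h2 s W2s.
rewrite pevalD !pevalM pevalC; split; first exact: mulf_neq0.
by field; rewrite q1s q2s.
Qed.

Lemma regular_onM e U f g :
  regular_on e U f -> regular_on e U g ->
  regular_on e U (fun t => f t * g t).
Proof.
move=> hf hg t Ut.
have [W1 [oW1 W1t W1U [p1 [q1 h1]]]] := hf t Ut.
have [W2 [oW2 W2t W2U [p2 [q2 h2]]]] := hg t Ut.
exists (W1 `&` W2); split=> //; [exact: zopenI | by move=> s [/W1U] |].
exists (p1 * p2), (q1 * q2) => s [W1s W2s].
have [q1s ->] := h1 s W1s; have [q2s ->] := h2 s W2s.
rewrite !pevalM; split; first exact: mulf_neq0.
by field; rewrite q1s q2s.
Qed.

(** Where [f] is nonzero, write [f = p / q] on a neighbourhood [W] and take [r] vanishing off [W].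
    Then [r * p] kills every zero of [f]: inside [W] through [p], outside through [r]. *)
Lemma zclosed_zeros e f :
  regular_on e setT f -> zclosed e [set t | f t = 0].
Proof.
move=> hf; rewrite -[X in zclosed e X]setCK; apply/zopenP => t ft.
have [W [/zopenP oW Wt _ [p [q h]]]] := hf t I.
have [r [rt rW]] := oW t Wt; exists (r * p).
have [qt ftE] := h t Wt; split.
  rewrite pevalM mulf_neq0 //; apply/eqP => p0; apply: ft.
  by rewrite /= ftE p0 mul0r.
move=> s /contrapT /= fs; rewrite pevalM.
case: (EM (W s)) => [Ws|/rW ->]; last by rewrite mul0r.
have [qs] := h s Ws; rewrite fs => /esym/eqP.
by rewrite mulf_eq0 invr_eq0 (negbTE qs) orbF => /eqP ->; rewrite mulr0.
Qed.

End ZariskiRegularity.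

(** * Linear spans and products of function spaces *)

Section SpansOfFunctions.
Context {R : realType} {G : groupType} {H : set G}.
Local Notation C := R[i].
Local Notation X := (homog H).
Implicit Types (V W : set (X -> C)) (f g : X -> C).

Lemma subspaceZ V (a : C) f : Defs.subspace V -> V f -> V (fun x => a * f x).
Proof.
move=> [V0 VD] Vf; rewrite (_ : (fun _ => _) = fun x => a * f x + 0).
  exact: VD.
by apply/funext => x; rewrite addr0.
Qed.

Lemma subspace_sum V (I : Type) (r : seq I) (P : pred I) (F : I -> X -> C) :
  Defs.subspace V -> (forall i, P i -> V (F i)) ->
  V (fun x => \sum_(i <- r | P i) F i x).
Proof.
move=> [V0 VD] VF; elim: r => [|i r IHr].
  by rewrite (_ : (fun _ => _) = fun=> 0) //; apply/funext => x; rewrite big_nil.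
have [Pi|nPi] := boolP (P i); last first.
  by congr (V _): IHr; apply/funext => x; rewrite big_cons (negbTE nPi).
congr (V _): (VD 1 _ _ (VF i Pi) IHr).
by apply/funext => x; rewrite big_cons Pi mul1r.
Qed.

Lemma subspaceI V W : Defs.subspace V -> Defs.subspace W -> Defs.subspace (V `&` W).
Proof.
move=> [V0 VD] [W0 WD]; split=> // a f g [Vf Wf] [Vg Wg].
by split; [apply: VD | apply: WD].
Qed.

Lemma product_span_subspace V W : Defs.subspace (product_span V W).
Proof.
split=> [U [] //|a f g hf hg U sU hU].
by case: (sU) => _; apply; [apply: hf | apply: hg].
Qed.

Lemma product_span_mul V W f g :
  V f -> W g -> product_span V W (fun x => f x * g x).
Proof. by move=> Vf Wg U _; apply; exists f, g. Qed.

Lemma product_span_translate V W a f :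
  (forall f, V f -> V (translate a f)) ->
  (forall f, W f -> W (translate a f)) ->
  product_span V W f -> product_span V W (translate a f).
Proof.
(* A span is the intersection of the subspaces containing its generators, so it suffices that the
   preimage of the span under translation is such a subspace. *)
move=> hV hW hf; apply: (hf [set f | product_span V W (translate a f)]).
  have [S0 SD] := product_span_subspace V W.
  by split=> // b u v; exact: SD.
move=> _ [u [v [Vu Wv ->]]].
exact: (product_span_mul (hV _ Vu) (hW _ Wv)).
Qed.

Lemma product_span_basis V W d1 d2 (u : 'I_d1 -> X -> C)
    (w : 'I_d2 -> X -> C) f :
  (forall v, V v -> exists a, v = (fun x => \sum_i a i * u i x)) ->
  (forall v, W v -> exists a, v = (fun x => \sum_i a i * w i x)) ->
  product_span V W f ->
  exists a, f = (fun x => \sum_i \sum_j a i j * (u i x * w j x)).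
Proof.
move=> hV hW hf; apply: (hf [set f | exists a : 'I_d1 -> 'I_d2 -> C,
  f = (fun x => \sum_i \sum_j a i j * (u i x * w j x))]).
  split=> [|c _ _ [a ->] [b ->]].
    exists (fun _ _ => 0); apply/funext => x.
    by rewrite big1 // => i _; rewrite big1 // => j _; rewrite mul0r.
  exists (fun i j => c * a i j + b i j); apply/funext => x.
  rewrite mulr_sumr -big_split; apply: eq_bigr => i _ /=.
  rewrite mulr_sumr -big_split; apply: eq_bigr => j _ /=.
  by rewrite mulrDl mulrA.
move=> _ [_ [_ [/hV[a ->] /hW[b ->] ->]]].
exists (fun i j => a i * b j); apply/funext => x.
rewrite mulr_suml; apply: eq_bigr => i _.
by rewrite mulr_sumr; apply: eq_bigr => j _; rewrite mulrACA.
Qed.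

End SpansOfFunctions.

(** * Norm bounds for bilinear combinations *)

Section NormEstimates.
Context {R : realType}.
Local Notation C := R[i].

Lemma normc_ge0 (z : C) : 0 <= Normc.normc z.
Proof. by case: z => a b; rewrite /= sqrtr_ge0. Qed.

Lemma normc_sum (I : Type) (r : seq I) (F : I -> C) :
  Normc.normc (\sum_(i <- r) F i) <= \sum_(i <- r) Normc.normc (F i).
Proof.
elim: r => [|i r IHr]; first by rewrite !big_nil Normc.normc0.
rewrite !big_cons; apply: le_trans (complex.le_normcD _ _) _.
by rewrite lerD2l.
Qed.

(** At the values of an orthonormal basis at [x], this is the spherical function at [x] up to a
    positive factor. *)
Definition sqnorm (d : nat) (z : 'I_d -> C) : R :=
  \sum_(i < d) Normc.normc (z i) ^+ 2.

Lemma sqnorm_ge0 d (z : 'I_d -> C) : 0 <= sqnorm z.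
Proof. by apply: sumr_ge0 => i _; rewrite sqr_ge0. Qed.

Lemma normc_le_sqnorm d (z : 'I_d -> C) i :
  Normc.normc (z i) <= Num.sqrt (sqnorm z).
Proof.
rewrite -[X in X <= _](ger0_norm (normc_ge0 _)) -sqrtr_sqr ler_wsqrtr //.
rewrite /sqnorm (bigD1 i) //= lerDl.
by apply: sumr_ge0 => j _; rewrite sqr_ge0.
Qed.

Lemma sqnorm_bilinear d d1 d2 (a : 'I_d -> 'I_d1 -> 'I_d2 -> C) :
  exists2 A : R, 0 < A & forall (u : 'I_d1 -> C) (w : 'I_d2 -> C),
    sqnorm (fun k => \sum_i \sum_j a k i j * (u i * w j))
      <= A * (sqnorm u * sqnorm w).
Proof.
pose b k := \sum_i \sum_j Normc.normc (a k i j).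
(* By the triangle inequality the [k]-th entry has modulus at most [b k] times both norms. The
   summand 1 keeps the constant positive when all coefficients vanish. *)
exists (1 + \sum_k b k ^+ 2) => [|u w].
  by rewrite ltr_wpDr // sumr_ge0 // => k _; rewrite sqr_ge0.
set s := Num.sqrt (sqnorm u) * Num.sqrt (sqnorm w).
have sE : s ^+ 2 = sqnorm u * sqnorm w.
  by rewrite exprMn !sqr_sqrtr ?sqnorm_ge0.
rewrite -sE mulrDl mul1r ler_wpDl ?sqr_ge0 // mulr_suml.
apply: ler_sum => k _; rewrite -exprMn ler_sqr ?nnegrE; first last.
- by rewrite mulr_ge0 ?mulr_ge0 ?sqrtr_ge0 ?sumr_ge0 // => i _;
    rewrite sumr_ge0 // => j _; exact: normc_ge0.
- exact: normc_ge0.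
apply: le_trans (normc_sum _ _) _; rewrite mulr_suml; apply: ler_sum => i _.
apply: le_trans (normc_sum _ _) _; rewrite mulr_suml; apply: ler_sum => j _.
rewrite !Normc.normcM ler_wpM2l ?normc_ge0 //.
by rewrite ler_pM ?normc_ge0 ?normc_le_sqnorm.
Qed.

End NormEstimates.

(** * Eigenfunctions of the Borel subgroup and irreducible submodules *)

Section Eigenfunctions.
Context {R : realType} {n : nat} {G : groupType}.
Local Notation C := R[i].
Variables (rho : G -> 'M[C]_n) (B H : set G).
Hypotheses (hB : subgroup B) (hsph : spherical rho H B).
Local Notation X := (homog H).
Implicit Types (V W : set (X -> C)) (f g : X -> C) (chi psi : @weight R G B).

(** Zero is allowed, unlike for highest weight vectors, so that the eigenfunctions of a fixed weight
    are closed under linear combinations. *)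
Definition eigenfunction chi f :=
  forall b : {b : G | B b}, translate (sval b) f = (fun x => chi b * f x).

Lemma regfun_lin (a : C) f g :
  regfun rho f -> regfun rho g -> regfun rho (fun x => a * f x + g x).
Proof. exact: regular_on_lin. Qed.

Lemma regfunM f g :
  regfun rho f -> regfun rho g -> regfun rho (fun x => f x * g x).
Proof. exact: regular_onM. Qed.

Lemma eigenfunction_lin chi (a : C) f g :
  eigenfunction chi f -> eigenfunction chi g ->
  eigenfunction chi (fun x => a * f x + g x).
Proof.
move=> hf hg b; apply/funext => x; rewrite mulrDr [chi b * _]mulrCA.
by rewrite -[chi b * f x](congr1 (@^~ x) (hf b)) -(congr1 (@^~ x) (hg b)).
Qed.

Lemma eigenfunctionM chi psi f g :
  eigenfunction chi f -> eigenfunction psi g ->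
  eigenfunction (weight_add chi psi) (fun x => f x * g x).
Proof.
move=> hf hg b; apply/funext => x; rewrite /weight_add mulrACA.
by rewrite -(congr1 (@^~ x) (hf b)) -(congr1 (@^~ x) (hg b)).
Qed.

Lemma eigenfunction_basepoint :
  exists x0 : X, forall chi f, regfun rho f -> eigenfunction chi f ->
    f x0 = 0 -> f = (fun=> 0).
Proof.
case: hsph => x0 dense; exists x0 => chi f rf ef fx0.
have [_ _ Binv] := hB.
have ZT : [set x | f x = 0] = setT.
  apply: dense; first exact: zclosed_zeros.
  (* Translation by [b^-1] evaluates at [act b x], so the eigenfunction equation for the inverse
     carries the zero at [x0] along the whole orbit. *)
  move=> b /Binv Bb.
  have /= := congr1 (@^~ x0) (ef (exist _ _ Bb)).
  by rewrite /translate invgK fx0 mulr0.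
by apply/funext => x; have : [set x | f x = 0] x by rewrite ZT.
Qed.

Lemma eigenfunction_proportional chi f g :
  regfun rho f -> regfun rho g -> eigenfunction chi f -> eigenfunction chi g ->
  g <> (fun=> 0) -> exists a : C, f = (fun x => a * g x).
Proof.
move=> rf rg ef eg g0; have [x0 hx0] := eigenfunction_basepoint.
have gx0 : g x0 != 0 by apply/eqP => /(hx0 _ _ rg eg).
exists (f x0 / g x0); apply/funext => x; apply/esym/eqP; rewrite -subr_eq0.
(* The coefficient is chosen so that this regular eigenfunction of weight [chi] vanishes at [x0]. *)
have : (fun y => - (f x0 / g x0) * g y + f y) = (fun=> 0).
  apply: (hx0 chi); [exact: regfun_lin | exact: eigenfunction_lin |].
  by rewrite mulNr divfK ?addNr.
by move/(congr1 (@^~ x)) => /= /eqP; rewrite -oppr_eq0 mulNr opprD opprK.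
Qed.

(** The intersection of [V] and [W] is a submodule of [V] containing the nonzero [f], hence all of
    [V]. *)
Lemma irreducible_sub V W f :
  irreducible rho V -> submodule rho W -> V f -> W f -> f <> (fun=> 0) ->
  V `<=` W.
Proof.
move=> [[sV rV tV] _ minV] [sW rW tW] Vf Wf f0.
have sVW : submodule rho (V `&` W).
  split; [exact: subspaceI | by move=> g [/rV] |].
  by move=> g h [Vh Wh]; split; [apply: tV | apply: tW].
case: (minV _ sVW) => [g [] // | VW0 | <- g []//].
by case: f0; have : (V `&` W) f by []; rewrite VW0.
Qed.

Lemma irreducible_of_highest_weight_unique chi V W :
  irreducible_of_highest_weight rho chi V ->
  irreducible_of_highest_weight rho chi W -> V = W.
Proof.
move=> [iV _ [f Vf [f0 ef]]] [iW _ [g Wg [g0 eg]]].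
have [sV _ _] := iV; have [sW _ _] := iW.
have [sbV rV _] := sV; have [sbW rW _] := sW.
have [a fE] := eigenfunction_proportional (rV _ Vf) (rW _ Wg) ef eg g0.
have Wf : W f by rewrite fE; apply: subspaceZ.
by rewrite eqEsubset; split; exact: (irreducible_sub _ _ _ _ f0).
Qed.

Lemma product_span_submodule V W :
  submodule rho V -> submodule rho W -> submodule rho (product_span V W).
Proof.
move=> [sV rV tV] [sW rW tW]; split.
- exact: product_span_subspace.
- move=> f; apply.
    split; last by move=> *; exact: regfun_lin.
    by have [V0 _] := sV; exact: rV.
  by move=> _ [u [v [/rV ru /rW rv ->]]]; exact: regfunM.
- move=> a f; apply: product_span_translate; [exact: tV | exact: tW].
Qed.

Lemma eigenfunction_component (V : @weight R G B -> set (X -> C)) chi f :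
  multiplicity_free_decomposition rho V ->
  regfun rho f -> eigenfunction chi f -> f <> (fun=> 0) ->
  exists2 lambda, Lambda_plus rho H lambda & V lambda f.
Proof.
move=> [irrV sumV dirV] rf ef f0.
have [m [l [F [Ll VF fE]]]] := sumV f rf.
(* The weights [l i] may repeat, while directness concerns pairwise distinct weights. So list the
   distinct ones, using classical decidable equality, and group the terms of equal weight into
   [F']. *)
pose s := undup [seq (l i : {classic @weight R G B}) | i <- enum 'I_m].
have ls i : (l i : {classic @weight R G B}) \in s by rewrite mem_undup map_f ?mem_enum.
pose l' (k : 'I_(size s)) : @weight R G B := tnth (in_tuple s) k.
have l'_inj : injective l'.
  by move=> j k; apply: tuple_uniqP; exact: undup_uniq.
have Ll' k : Lambda_plus rho H (l' k).
  have : l' k \in (s : seq {classic @weight R G B}) := mem_tnth _ _.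
  by rewrite mem_undup => /mapP[i _ ->].
have subV lambda : Lambda_plus rho H lambda -> submodule rho (V lambda).
  by move/irrV => [[]].
pose F' k x := \sum_(i < m | (l i : {classic @weight R G B}) == l' k) F i x.
have VF' k : V (l' k) (F' k).
  have [sV _ _] := subV _ (Ll' k).
  by apply: subspace_sum => // i /eqP <-.
have fE' : f = (fun x => \sum_k F' k x).
  rewrite fE; apply/funext => x.
  have idx i : exists k, l' k = l i.
    have /tnthP[k ->] : (l i : {classic @weight R G B}) \in in_tuple s by exact: ls.
    by exists k.
  have [p pE] := choice idx.
  rewrite (partition_big p xpredT) //=; apply: eq_bigr => k _.
  apply: eq_bigl => i /=; rewrite -pE; apply/eqP/eqP => [<- //|/l'_inj //].
have eF' k : eigenfunction chi (F' k).
  (* The defect [D k] stays in the summand [V (l' k)], and the defects add up to that of [f], which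
     is zero. Directness kills each one. *)
  move=> b; pose D k x := - chi b * F' k x + translate (sval b) (F' k) x.
  have VD j : V (l' j) (D j).
    have [[_ VD] _ Vt] := subV _ (Ll' j).
    by apply: VD => //; apply: Vt.
  have D0 x : \sum_k D k x = 0.
    rewrite big_split -mulr_sumr /=.
    have := congr1 (@^~ x) (ef b); rewrite fE' /translate /= => ->.
    by rewrite mulNr addNr.
  have := dirV _ _ _ l'_inj Ll' VD D0 k.
  move=> Dk; apply/funext => x; have /= := congr1 (@^~ x) Dk.
  by rewrite /D mulNr addrC => /eqP; rewrite subr_eq0 => /eqP.
have [k Fk0] : exists k, F' k <> (fun=> 0).
  apply: contrapT => h; apply: f0; rewrite fE'; apply/funext => x.
  apply: big1 => k _; have [->//|Fk] := EM (F' k = (fun=> 0)).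
  by case: h; exists k.
have [sV rV _] := subV _ (Ll' k).
have [a faE] := eigenfunction_proportional rf (rV _ (VF' k)) ef (eF' k) Fk0.
by exists (l' k) => //; rewrite faE; apply: subspaceZ.
Qed.

Lemma appears_weight_add (V : @weight R G B -> set (X -> C)) lambda mu :
  multiplicity_free_decomposition rho V ->
  Lambda_plus rho H lambda -> Lambda_plus rho H mu ->
  appears rho (weight_add lambda mu) (product_span (V lambda) (V mu)).
Proof.
move=> hV Llambda Lmu; have [irrV _ _] := hV.
have [iV [c1 cM creg] [f Vf [f0 ef]]] := irrV _ Llambda.
have [iW [d1 dM dreg] [g Vg [g0 eg]]] := irrV _ Lmu.
have [sV _ _] := iV; have [sW _ _] := iW.
have [_ rV _] := sV; have [_ rW _] := sW.
have efg := eigenfunctionM ef eg.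
have rfg := regfunM (rV _ Vf) (rW _ Vg).
have fg0 : (fun x => f x * g x) <> (fun=> 0).
  have [x0 hx0] := eigenfunction_basepoint => /(congr1 (@^~ x0))/eqP.
  rewrite mulf_eq0 => /orP[/eqP/(hx0 _ _ (rV _ Vf) ef)|] //.
  by move=> /eqP/(hx0 _ _ (rW _ Vg) eg).
have [nu Lnu Vnu] := eigenfunction_component hV rfg efg fg0.
have [iU _ _] := irrV _ Lnu.
(* The irreducible summand containing the product serves as witness: the product is itself an
   eigenvector of weight [weight_add lambda mu]. *)
exists (V nu).
  split=> //; last by exists (fun x => f x * g x).
  split; [| |exact: regular_onM].
  - by move=> b b1; rewrite /weight_add c1 // d1 // mulr1.
  - move=> a b c abc; rewrite /weight_add (cM _ _ _ abc) (dM _ _ _ abc).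
    by rewrite mulrACA.
apply: (irreducible_sub iU _ Vnu _ fg0); first exact: product_span_submodule.
exact: product_span_mul.
Qed.

End Eigenfunctions.

(** * The inequality between spherical functions *)

Lemma spherical_function_product_ge (R : realType) (G : groupType)
    (K H : set G) (V W U : set (homog H -> R[i])) (phi psi chi : homog H -> R) :
  spherical_function K V phi -> spherical_function K W psi ->
  spherical_function K U chi -> U `<=` product_span V W ->
  exists2 c : R, 0 < c & forall x, phi x * psi x >= c * chi x.
Proof.
move=> [_ [d1 [u [c1 [_ [_ _ uV] c10 phiE _]]]]].
move=> [_ [d2 [w [c2 [_ [_ _ wW] c20 psiE _]]]]].
move=> [_ [d [v [c [_ [vU _ _] c0 chiE _]]]]] UVW.
have /choice[a aE] k := product_span_basis uV wW (UVW _ (vU k)).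
have [A A0 hA] := sqnorm_bilinear a.
(* The factors [c1], [c2] and [c] are the normalizations of [phi], [psi] and [chi]; [A] bounds the
   squared norm of the [v] values by the product of those of [u] and [w]. *)
exists (c1 * c2 / (c * A)) => [|x]; first by rewrite !(mulr_gt0, invr_gt0).
rewrite phiE psiE chiE -/(sqnorm (u ^~ x)) -/(sqnorm (w ^~ x)).
rewrite -/(sqnorm (v ^~ x)).
have -> : sqnorm (v ^~ x) =
    sqnorm (fun k => \sum_i \sum_j a k i j * (u i x * w j x)).
  by apply: eq_bigr => k _; rewrite aE.
have -> t : c1 * c2 / (c * A) * (c * t) = c1 * c2 * (t / A).
  by field; rewrite !gt_eqF.
by rewrite [leRHS]mulrACA ler_pM2l ?mulr_gt0 // ler_pdivrMr // mulrC hA.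
Qed.

Theorem theorem2 (R : realType) (n : nat) (G : groupType)
    (rho : G -> 'M[R[i]]_n) (B K H : set G)
    (hG : linear_algebraic_group rho)
    (hGconn : zconnected (group_coord rho) [set: G])
    (hGred : reductive rho)
    (hB : borel rho B)
    (hK : maximal_compact rho K)
    (hH : closed_subgroup rho H)
    (hqa : quasi_affine rho H)
    (hsph : spherical rho H B)
    (V : weight B -> set (homog H -> R[i]))
    (hV : multiplicity_free_decomposition rho V)
    (phi : weight B -> homog H -> R)
    (hphi : forall lambda, Lambda_plus rho H lambda ->
      spherical_function K (V lambda) (phi lambda)) :
  (forall lambda mu gamma : weight B,
     Lambda_plus rho H lambda -> Lambda_plus rho H mu ->
     appears rho gamma (product_span (V lambda) (V mu)) ->
     exists2 c : R, 0 < c &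
       forall x, phi lambda x * phi mu x >= c * phi gamma x)
  /\
  (forall lambda mu : weight B,
     Lambda_plus rho H lambda -> Lambda_plus rho H mu ->
     appears rho (weight_add lambda mu) (product_span (V lambda) (V mu)) /\
     exists2 c : R, 0 < c &
       forall x, phi lambda x * phi mu x >= c * phi (weight_add lambda mu) x).
Proof.
have [[[Bsub _] _ _] _] := hB.
have [irrV _ _] := hV.
have part1 lambda mu gamma : Lambda_plus rho H lambda -> Lambda_plus rho H mu ->
    appears rho gamma (product_span (V lambda) (V mu)) ->
    exists2 c : R, 0 < c & forall x, phi lambda x * phi mu x >= c * phi gamma x.
  move=> Llambda Lmu [W hW WVV].
  (* The copy [W] consists of regular functions, so [gamma] occurs in the coordinate ring and
     [phi gamma] is a spherical function of [V gamma]. *)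
  have Lgamma : Lambda_plus rho H gamma.
    by exists W => //; have [[[]]] := hW.
  apply: spherical_function_product_ge (hphi _ Llambda) (hphi _ Lmu) (hphi _ Lgamma) _.
  (* Uniqueness identifies [V gamma] with [W], which lies in the product span. *)
  by rewrite (irreducible_of_highest_weight_unique Bsub hsph (irrV _ Lgamma) hW).
split=> // lambda mu Llambda Lmu.
have app : appears rho (weight_add lambda mu) (product_span (V lambda) (V mu)).
  exact: appears_weight_add.
by split=> //; exact: part1.
Qed.
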